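(* Let $\mathcal{H}$ be a Hilbert space, let $A,B\in\mathcal{B}(\mathcal{H})$ be two positive invertible operators, and let $m,M$ be real numbers such that $0<m\mathbf{1}_{\mathcal{H}}\le \mathbf{1}_{\mathcal{H}}\le A^{-\frac12}BA^{-\frac12}\le M\mathbf{1}_{\mathcal{H}}$. Let $\Phi$ be a unital positive linear map on $\mathcal{B}(\mathcal{H})$. (1) If $-1\le p\le 1$ with $p\neq 0$, then $$T_p(\Phi(A)|\Phi(B))\le \Phi(T_p(A|B))+\left(m^{p-1}-M^{p-1}\right)\Phi(B-A).$$ (2) If $1\le p\le 2$, then $$\Phi(T_p(A|B))\le T_p(\Phi(A)|\Phi(B))+\left(M^{p-1}-m^{p-1}\right)\Phi(B-A).$$
   Context: $\mathcal{B}(\mathcal{H})$ is the $C^*$-algebra of all bounded linear operators on the Hilbert space $\mathcal{H}$, and $\mathbf{1}_{\mathcal{H}}$ is the identity operator. $X\le Y$ means that $X$ and $Y$ are self-adjoint and $Y-X$ is positive (positive means positive semidefinite); $0<X$ means that $X$ is positive and invertible. A linear map $\Phi:\mathcal{B}(\mathcal{H})\to\mathcal{B}(\mathcal{H})$ is positive if it maps positive operators to positive operators, and unital if $\Phi(\mathbf{1}_{\mathcal{H}})=\mathbf{1}_{\mathcal{H}}$. For invertible positive operators $A,B$ and $p\in\mathbb{R}$, set $A\natural_p B=A^{\frac12}\left(A^{-\frac12}BA^{-\frac12}\right)^pA^{\frac12}$. For $p\ne 0$ the Tsallis relative operator entropy is $T_p(A|B):=\dfrac{A\natural_p B-A}{p}$.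 *)

(* Defs.v *)
From HB Require Import structures.
From mathcomp Require Import all_boot all_order all_algebra.
From mathcomp Require Import sesquilinear complex.
From mathcomp Require Import all_classical all_reals all_analysis.

Set Implicit Arguments.
Unset Strict Implicit.
Unset Printing Implicit Defensive.

Import Order.TTheory GRing.Theory Num.Theory.
Import numFieldNormedType.Exports.

Local Open Scope classical_set_scope.
Local Open Scope complex_scope.
Local Open Scope ring_scope.

(* Complex Hilbert spaces, with scalars R[i] for R an arbitrary [realType].
   [inner] is linear in its first argument and conjugate-linear in its second
   one; completeness is that of the underlying normed module. *)
HB.mixin Record NormedModule_isHilbert (R : realType) H
    of CompleteNormedModule R[i] H := {
  inner : {dot H for @Num.conj R[i]} ;
  inner_norm : forall x : H, inner x x = `|x| ^+ 2
}.

#[short(type="hilbertType")]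
HB.structure Definition Hilbert (R : realType) :=
  {H of CompleteNormedModule R[i] H & NormedModule_isHilbert R H}.

Section BoundedOperators.
Variables (R : realType) (H : hilbertType R).
Local Notation C := R[i].

Definition bounded_linear : {pred H -> H} :=
  [pred f : H -> H |
    `[< linear f /\ exists k : C, forall x, `|f x| <= k * `|x| >]].

Lemma bounded_linearP (f : H -> H) :
  reflect (linear f /\ exists k : C, forall x, `|f x| <= k * `|x|)
          (f \in bounded_linear).
Proof. by rewrite inE; exact: asboolP. Qed.

Lemma bounded_linear_ge0 (f : H -> H) : f \in bounded_linear ->
  exists2 k : C, 0 <= k & forall x, `|f x| <= k * `|x|.
Proof.
move=> /bounded_linearP[_ [k fk]]; exists `|k| => // x.
rewrite -(normr_id x) -normrM ger0_norm //.
exact: le_trans (normr_ge0 _) (fk x).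
Qed.

Fact bounded_linear_submod_closed : submod_closed bounded_linear.
Proof.
split=> [|a f g fB gB]; apply/bounded_linearP; split.
- by move=> a x y; rewrite scaler0 addr0.
- by exists 0 => x; rewrite normr0 mul0r.
- have [[flin _] [glin _]] := (bounded_linearP _ fB, bounded_linearP _ gB).
  move=> b x y; rewrite /= !fctE flin glin !scalerDr !scalerA addrACA.
  by rewrite (mulrC a b).
- have [k k0 fk] := bounded_linear_ge0 fB.
  have [l l0 gl] := bounded_linear_ge0 gB.
  exists (`|a| * k + l) => x; rewrite mulrDl -mulrA.
  apply: le_trans (ler_normD _ _) _; apply: lerD => //.
  by rewrite normrZ ler_wpM2l.
Qed.

HB.instance Definition _ :=
  GRing.isSubmodClosed.Build C (H -> H) bounded_linear
    bounded_linear_submod_closed.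

Record bop := BOp { bop_fun :> H -> H ; bop_funP : bop_fun \in bounded_linear }.

HB.instance Definition _ := [isSub for bop_fun].
HB.instance Definition _ := [Choice of bop by <:].
HB.instance Definition _ := [SubChoice_isSubLmodule of bop by <:].

Implicit Types X Y Z : bop.

Fact bounded_linear_id : idfun \in bounded_linear.
Proof.
by apply/bounded_linearP; split=> //; exists 1 => x; rewrite mul1r.
Qed.

Fact bounded_linear_comp X Y : X \o Y \in bounded_linear.
Proof.
have [[Xlin _] [Ylin _]] :=
  (bounded_linearP _ (bop_funP X), bounded_linearP _ (bop_funP Y)).
have [k k0 Xk] := bounded_linear_ge0 (bop_funP X).
have [l l0 Yl] := bounded_linear_ge0 (bop_funP Y).
apply/bounded_linearP; split=> [a x y|] /=; first by rewrite Ylin Xlin.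
exists (k * l) => x; apply: le_trans (Xk _) _.
by rewrite -mulrA ler_wpM2l.
Qed.

Definition bop_one : bop := BOp bounded_linear_id.
Definition bop_mul X Y : bop := BOp (bounded_linear_comp X Y).

Lemma bopP X Y : X =1 Y -> X = Y.
Proof. by move=> XY; apply/val_inj/funext. Qed.

Fact bop_mulA : associative bop_mul.
Proof. by move=> X Y Z; exact: bopP. Qed.
Fact bop_mul1l : left_id bop_one bop_mul.
Proof. by move=> X; exact: bopP. Qed.
Fact bop_mul1r : right_id bop_one bop_mul.
Proof. by move=> X; exact: bopP. Qed.
Fact bop_mulDl : left_distributive bop_mul +%R.
Proof. by move=> X Y Z; exact: bopP. Qed.
Fact bop_mulDr : right_distributive bop_mul +%R.
Proof.
move=> X Y Z; apply: bopP => x /=.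
have [Xlin _] := bounded_linearP _ (bop_funP X).
by have := Xlin 1 (Y x) (Z x); rewrite !scale1r.
Qed.

(* B(H) is trivial when H is, so it is only a [pzRingType]. *)
HB.instance Definition _ := GRing.Zmodule_isPzRing.Build bop
  bop_mulA bop_mul1l bop_mul1r bop_mulDl bop_mulDr.

Definition selfadjoint X := forall x y : H, inner (X x) y = inner x (X y).

(* In [R[i]], [0 <= z] means that z is real and nonnegative; hence a positive
   operator is self-adjoint. *)
Definition positive X := forall x : H, 0 <= inner (X x) x.

Definition invertible X := exists Y, X * Y = 1 /\ Y * X = 1.

Definition op_le X Y :=
  [/\ selfadjoint X, selfadjoint Y & positive (Y - X)].

Definition op_gt0 X := positive X /\ invertible X.

Definition spectrum X : set C := [set z | ~ invertible (z *: (1 : bop) - X)].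

Definition op_poly (q : {poly R}) X : bop :=
  \sum_(i < size q) (q`_i)%:C *: (X ^+ i : bop).

(* [u n - Y] has operator norm at most [e] for n large: norm convergence. *)
Definition op_cvg (u : nat -> bop) Y :=
  forall e : C, 0 < e ->
    \forall n \near \oo, forall x : H, `|u n x - Y x| <= e * `|x|.

Definition unif_cvg_on (A : set R) (q : nat -> {poly R}) (f : R -> R) :=
  forall e : R, 0 < e ->
    \forall n \near \oo, forall t, A t -> `|(q n).[t] - f t| <= e.

(* Continuous functional calculus: for X self-adjoint and f continuous on the
   spectrum of X (a compact subset of the real line), f(X) is the norm limit of
   q_n(X) for any polynomials q_n converging to f uniformly on the spectrum.
   The limit does not depend on (q_n), so [op_fun] below has only one choice;
   [op_fun] is junk for other f and X. *)
Definition is_op_fun (f : R -> R) X Y :=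
  exists q : nat -> {poly R},
    unif_cvg_on [set t | spectrum X t%:C] q f /\
    op_cvg (fun n => op_poly (q n) X) Y.

Definition op_fun (f : R -> R) X : bop := xget 0 [set Y | is_op_fun f X Y].

Definition op_pow X (p : R) : bop := op_fun (fun t => t `^ p) X.

Definition natural_pow (p : R) (A B : bop) : bop :=
  let A12 := op_pow A 2^-1 in
  let A12i := op_pow A (- 2^-1) in
  A12 * op_pow (A12i * B * A12i) p * A12.

Definition tsallis (p : R) (A B : bop) : bop :=
  (p^-1)%:C *: (natural_pow p A B - A).

Definition positive_map (Phi : bop -> bop) :=
  forall X, positive X -> positive (Phi X).

Definition unital_map (Phi : bop -> bop) := Phi 1 = 1.

End BoundedOperators.

Arguments bop {R} H.
Notation "''B' ( H )" := (bop H) (at level 8, format "''B' ( H )") : type_scope.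

(* Main.v *)
Require Import Defs.
From HB Require Import structures.
From mathcomp Require Import all_boot all_order all_algebra.
From mathcomp Require Import sesquilinear complex ring lra.
From mathcomp Require Import all_classical all_reals all_analysis.

(** Put [f(t) = (t^p - 1) / p]. By the mean value theorem
    [f(t) = c^(p-1) (t - 1)] for some [c] between [1] and [t], so that on the
    interval from [1] to [M], which lies to the right of [m], the function [f]
    is squeezed between [M^(p-1) (t - 1)] and [m^(p-1) (t - 1)] when [p <= 1],
    and in the opposite order when [p >= 1] ([tsallis_fun_concave],
    [tsallis_fun_convex]).

    The functional calculus of [X = A^(-1/2) B A^(-1/2)], followed by the
    congruence with [A^(1/2)], turns these scalar inequalities into bounds of
    [T_p(A|B)] by multiples of [B - A] ([tsallis_ge], [tsallis_le]). They require
    only [A <= B <= M A]. A unital positive map [Phi] preserves these relations,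
    so the same two bounds hold for [T_p(Phi A|Phi B)] with [Phi (B - A)]. Hence
    [Phi (T_p(A|B))] and [T_p(Phi A|Phi B)] lie between the same multiples
    of [Phi (B - A)], and differ by at most the gap between them.

    Most of the file builds the functional calculus. Its heart is
    [op_poly_positive]: a real polynomial that is nonnegative on the spectrum of
    a self-adjoint operator [X] has a positive value at [X]. This follows from
    the invertibility of operators bounded below by a positive constant
    ([positive_invertible], a Neumann series), from the presence of the bottom
    of a self-adjoint operator in its spectrum ([selfadjoint_bottom]), and from
    the factorization of polynomials over the complex numbers
    ([op_poly_noninvertible]). It yields both the existence of [X^p], through
    Bernstein polynomials ([lipschitz_unif_approx], [op_powP]), and the
    monotonicity of the calculus ([is_op_fun_le]), from which the algebraic
    identities between powers follow. *)

Set Implicit Arguments.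
Unset Strict Implicit.
Unset Printing Implicit Defensive.

Import Order.TTheory GRing.Theory Num.Theory.
Import numFieldNormedType.Exports.

Local Open Scope classical_set_scope.
Local Open Scope complex_scope.
Local Open Scope ring_scope.

(** * The real inner product of a complex Hilbert space *)

Section RealInnerProduct.
Variables (R : realType) (H : hilbertType R).
Implicit Types (x y z : H) (a k : R).

(** Complex scalars are only partially ordered; taking real parts moves all
    estimates to [R]. No information is lost, since [Im_inner] recovers the
    imaginary part of [inner] from [rdot]. *)
Definition rdot x y : R := complex.Re (inner x y).
Definition rnorm x : R := complex.Re `|x|.

Lemma normE x : `|x| = (rnorm x)%:C.
Proof. by rewrite /rnorm RRe_real// ger0_real. Qed.

Lemma rnorm_ge0 x : 0 <= rnorm x.
Proof. by have := normr_ge0 x; rewrite normE ler0c. Qed.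

Lemma rnorm_eq0 x : rnorm x = 0 -> x = 0.
Proof. by move=> x0; apply/normr0_eq0; rewrite normE x0. Qed.

Lemma rnormZ a x : rnorm (a%:C *: x) = `|a| * rnorm x.
Proof.
apply: complexI; rewrite -normE normrZ rmorphM/= -normE; congr (_ * _).
by rewrite normc_def/= expr0n addr0 sqrtr_sqr.
Qed.

Lemma rnormN x : rnorm (- x) = rnorm x.
Proof. by rewrite /rnorm normrN. Qed.

Lemma rnormD x y : rnorm (x + y) <= rnorm x + rnorm y.
Proof. by rewrite -lecR rmorphD/= -!normE ler_normD. Qed.

Lemma rdotC x y : rdot x y = rdot y x.
Proof.
by rewrite /rdot (hermC inner)/= expr0 mul1r; case: (inner y x).
Qed.

Lemma rdotDl x y z : rdot (x + y) z = rdot x z + rdot y z.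
Proof. by rewrite /rdot linearDl/= raddfD. Qed.

Lemma rdotNl x y : rdot (- x) y = - rdot x y.
Proof. by rewrite /rdot linearNl/= raddfN. Qed.

Lemma rdotZl a x y : rdot (a%:C *: x) y = a * rdot x y.
Proof.
by rewrite /rdot linearZl_LR/=; case: (inner x y) => u v /=; rewrite mul0r subr0.
Qed.

Lemma rdotDr x y z : rdot x (y + z) = rdot x y + rdot x z.
Proof. by rewrite rdotC rdotDl !(rdotC x). Qed.

Lemma rdotNr x y : rdot x (- y) = - rdot x y.
Proof. by rewrite rdotC rdotNl rdotC. Qed.

Lemma rdotZr a x y : rdot x (a%:C *: y) = a * rdot x y.
Proof. by rewrite rdotC rdotZl rdotC. Qed.

Lemma rdot0r x : rdot x 0 = 0.
Proof. by rewrite -(scale0r 0) rdotZr mul0r. Qed.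

Lemma rdotxx x : rdot x x = rnorm x ^+ 2.
Proof.
apply: complexI; rewrite rmorphXn/= -normE -inner_norm RRe_real//.
by rewrite inner_norm realX.
Qed.

Definition rdotE := (rdotDl, rdotDr, rdotNl, rdotNr, rdotZl, rdotZr).

(** Cauchy-Schwarz, read off the triangle inequality that the norm of a normed
    module already satisfies. *)
Lemma rdot_le x y : `|rdot x y| <= rnorm x * rnorm y.
Proof.
suff le z : rdot x z <= rnorm x * rnorm z.
  by rewrite ler_norml le andbT lerNl -rdotNr -(rnormN y).
have : rnorm (x + z) ^+ 2 <= (rnorm x + rnorm z) ^+ 2.
  by rewrite ler_sqr ?nnegrE ?addr_ge0 ?rnorm_ge0// rnormD.
rewrite -!rdotxx !rdotE !rdotxx (rdotC z); lra.
Qed.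

Lemma Im_inner x y : complex.Im (inner x y) = rdot x ('i *: y).
Proof.
rewrite rdotC /rdot linearZl_LR/= (hermC inner)/= expr0 mul1r.
by case: (inner y x) => u v /=; rewrite mul0r mul1r sub0r.
Qed.

End RealInnerProduct.

(** * Self-adjoint and positive operators *)

Section OperatorAlgebra.
Variables (R : realType) (H : hilbertType R).
Local Notation C := R[i].
Local Notation I := (1 : 'B(H)).
Implicit Types (x y z : H) (a b k s t : R) (X Y Z S T : 'B(H)).

Lemma bop_is_linear X : linear X.
Proof. by case: (bounded_linearP _ (bop_funP X)). Qed.

HB.instance Definition _ X := GRing.isLinear.Build C H H _ X (@bop_is_linear X).

(** [B(H)] is only a [pzRingType], as [H] may be trivial, hence not an algebra
    in the hierarchy; [bop_scaleAl] and [bop_scaleAr] are the algebra axioms. *)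
Lemma bop_scaleAl (c : C) X Y : c *: (X * Y) = (c *: X) * Y.
Proof. exact: bopP. Qed.

Lemma bop_scaleAr (c : C) X Y : c *: (X * Y) = X * (c *: Y).
Proof. by apply: bopP => x; rewrite /= linearZ. Qed.

Lemma rscale1 X : (1 : R)%:C *: X = X.
Proof. exact: scale1r. Qed.

Lemma rscaleN a X : (- a)%:C *: X = - (a%:C *: X).
Proof. by rewrite rmorphN scaleNr. Qed.

Lemma rscaleB a b X : (a - b)%:C *: X = a%:C *: X - b%:C *: X.
Proof. by rewrite rmorphB scalerBl. Qed.

Lemma bop_mulE X Y x : (X * Y) x = X (Y x). Proof. by []. Qed.
Lemma bop_addE X Y x : (X + Y) x = X x + Y x. Proof. by []. Qed.
Lemma bop_oppE X x : (- X) x = - X x. Proof. by []. Qed.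
Lemma bop_scaleE (c : C) X x : (c *: X) x = c *: X x. Proof. by []. Qed.
Lemma bop_oneE x : (1 : 'B(H)) x = x. Proof. by []. Qed.
Lemma bop_zeroE x : (0 : 'B(H)) x = 0. Proof. by []. Qed.
Definition bopE :=
  (bop_mulE, bop_addE, bop_oppE, bop_scaleE, bop_oneE, bop_zeroE).

Lemma selfadjointP X :
  selfadjoint X <-> forall x y, rdot (X x) y = rdot x (X y).
Proof.
split=> [sX x y|sX x y]; first by rewrite /rdot sX.
apply/eqP; rewrite eq_complex; apply/andP; split; apply/eqP; first exact: sX.
by rewrite !Im_inner sX linearZ.
Qed.

Lemma positive_selfadjoint X : positive X -> selfadjoint X.
Proof.
move=> X0; apply/selfadjointP => x y.
(* Polarization: [inner (X z) z] is real at [z = x + iy]. *)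
have im0 z : rdot (X z) ('i *: z) = 0.
  by rewrite -Im_inner; exact: ger0_Im (X0 z).
have iI z : 'i *: ('i *: z) = - z :> H.
  by rewrite scalerA -expr2 sqr_i scaleN1r.
have rdoti z w : rdot ('i *: z) ('i *: w) = rdot z w :> R.
  by rewrite -Im_inner /rdot linearZl_LR/=; case: (inner z w) => u v /=; ring.
have := im0 (x + 'i *: y).
rewrite scalerDr iI !linearD !linearZ/= !rdotE !im0 !rdoti.
have := im0 ('i *: y); rewrite iI linearZ/= rdotNr => /eqP.
rewrite oppr_eq0 => /eqP ->.
rewrite (rdotC x); lra.
Qed.

(** In terms of the real inner product, self-adjointness takes over the
    requirement that [inner (X x) x] be real. *)
Lemma positiveP X :
  positive X <-> selfadjoint X /\ forall x, 0 <= rdot (X x) x.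
Proof.
split=> [X0|[sX X0] x].
  split=> [|x]; first exact: positive_selfadjoint.
  by move: (X0 x); rewrite lecE => /andP[].
rewrite lecE/=; apply/andP; split; last exact: X0.
rewrite Im_inner; apply/eqP.
have := (selfadjointP X).1 sX x ('i *: x).
rewrite linearZ /= -[rdot x _]Im_inner -Im_inner (hermC inner)/= expr0 mul1r.
case: (inner x (X x)) => u v /= ?; lra.
Qed.

Lemma selfadjointD X Y : selfadjoint X -> selfadjoint Y -> selfadjoint (X + Y).
Proof. by rewrite !selfadjointP => sX sY x y; rewrite !bopE !rdotE sX sY. Qed.

Lemma selfadjointN X : selfadjoint X -> selfadjoint (- X).
Proof. by rewrite !selfadjointP => sX x y; rewrite !bopE !rdotE sX. Qed.

Lemma selfadjointB X Y : selfadjoint X -> selfadjoint Y -> selfadjoint (X - Y).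
Proof. by move=> ? ?; apply/selfadjointD => //; exact: selfadjointN. Qed.

Lemma selfadjointZ a X : selfadjoint X -> selfadjoint (a%:C *: X).
Proof. by rewrite !selfadjointP => sX x y; rewrite !bopE !rdotE sX. Qed.

Lemma selfadjoint0 : selfadjoint (0 : 'B(H)).
Proof. by apply/selfadjointP => x y; rewrite !bopE rdotC !rdot0r. Qed.

Lemma selfadjoint1 : selfadjoint (1 : 'B(H)).
Proof. by []. Qed.

Lemma selfadjoint_congr S X :
  selfadjoint S -> selfadjoint X -> selfadjoint (S * X * S).
Proof. by move=> sS sX x y; rewrite !bopE sS sX sS. Qed.

Lemma positiveD X Y : positive X -> positive Y -> positive (X + Y).
Proof.
by move=> X0 Y0 x; rewrite bopE linearDl; apply: addr_ge0; [exact: X0|exact: Y0].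
Qed.

Lemma positiveZ a X : 0 <= a -> positive X -> positive (a%:C *: X).
Proof.
move=> a0 X0 x; rewrite bopE linearZl_LR; apply: mulr_ge0; last exact: X0.
by rewrite ler0c.
Qed.

Lemma positive1 : positive (1 : 'B(H)).
Proof. by move=> x; rewrite bopE inner_norm exprn_ge0. Qed.

Lemma positive_congr S X : selfadjoint S -> positive X -> positive (S * X * S).
Proof. by move=> sS X0 x; rewrite !bopE sS; exact: X0. Qed.

Lemma op_leP X Y : selfadjoint X -> positive (Y - X) -> op_le X Y.
Proof.
move=> sX YX; split=> //; rewrite -(subrK X Y).
exact: selfadjointD (positive_selfadjoint YX) sX.
Qed.

Lemma op_le_congr S X Y : selfadjoint S -> op_le X Y ->
  op_le (S * X * S) (S * Y * S).
Proof.
move=> sS [sX sY XY]; apply: op_leP; first exact: selfadjoint_congr.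
by rewrite -mulrBl -mulrBr; exact: positive_congr.
Qed.

Lemma positive_scalarP a X : positive (X - a%:C *: I) <->
  selfadjoint X /\ forall x, a * rnorm x ^+ 2 <= rdot (X x) x.
Proof.
rewrite positiveP; split=> -[sX aX].
  split=> [|x]; last by have := aX x; rewrite !bopE !rdotE rdotxx; lra.
  by rewrite -(subrK (a%:C *: I) X); apply/selfadjointD/selfadjointZ.
split=> [|x]; first by apply/selfadjointB/selfadjointZ.
by rewrite !bopE !rdotE rdotxx subr_ge0.
Qed.

Lemma scalar_positiveP a X : positive (a%:C *: I - X) <->
  selfadjoint X /\ forall x, rdot (X x) x <= a * rnorm x ^+ 2.
Proof.
rewrite positiveP; split=> -[sX aX].
  split=> [|x]; last by have := aX x; rewrite !bopE !rdotE rdotxx; lra.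
  by rewrite -(subKr (a%:C *: I) X); apply/selfadjointB => //; apply/selfadjointZ.
split=> [|x]; first by apply/selfadjointB => //; apply/selfadjointZ.
by rewrite !bopE !rdotE rdotxx subr_ge0.
Qed.

(** Operator norms stay implicit: [op_bounded k X] says that the norm of [X] is
    at most [k]. *)
Definition op_bounded k X := forall x, rnorm (X x) <= k * rnorm x.

Lemma op_boundedE X : exists2 k, 0 < k & op_bounded k X.
Proof.
have [k k0 Xk] := bounded_linear_ge0 (bop_funP X).
have kR : k = (complex.Re k)%:C by rewrite RRe_real// ger0_real.
move: k0 Xk; rewrite kR ler0c => k0 Xk.
exists (complex.Re k + 1) => [|x]; first by rewrite ltr_wpDl.
have := Xk x; rewrite !normE -rmorphM/= lecR => /le_trans; apply.
by rewrite ler_wpM2r ?rnorm_ge0// lerDl.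
Qed.

Lemma op_bounded_le k l X : k <= l -> op_bounded k X -> op_bounded l X.
Proof.
by move=> kl Xk x; apply: le_trans (Xk x) _; rewrite ler_wpM2r ?rnorm_ge0.
Qed.

Lemma op_boundedD k l X Y :
  op_bounded k X -> op_bounded l Y -> op_bounded (k + l) (X + Y).
Proof.
move=> Xk Yl x; rewrite mulrDl; apply: le_trans (rnormD _ _) _.
exact: lerD (Xk x) (Yl x).
Qed.

Lemma op_boundedN k X : op_bounded k X -> op_bounded k (- X).
Proof. by move=> Xk x; rewrite bopE rnormN. Qed.

Lemma op_boundedM k l X Y : 0 <= k ->
  op_bounded k X -> op_bounded l Y -> op_bounded (k * l) (X * Y).
Proof.
move=> k0 Xk Yl x; rewrite bopE -mulrA; apply: le_trans (Xk _) _.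
by rewrite ler_wpM2l.
Qed.

Lemma op_bounded_eq0 X : (forall e, 0 < e -> op_bounded e X) -> X = 0.
Proof.
move=> Xe; apply: bopP => x; apply: rnorm_eq0; apply/eqP.
rewrite eq_le rnorm_ge0 andbT; apply/ler_addgt0Pl => e e0; rewrite addr0.
have n1 : 0 < rnorm x + 1 by rewrite ltr_wpDl// rnorm_ge0.
apply: le_trans (Xe (e / (rnorm x + 1)) _ x) _; first exact: divr_gt0.
by rewrite mulrAC ler_pdivrMr// ler_wpM2l// ?lerDl// ltW.
Qed.

Lemma op_bounded_sqr k X : 0 <= k ->
  (forall x, rnorm (X x) ^+ 2 <= k ^+ 2 * rnorm x ^+ 2) -> op_bounded k X.
Proof.
move=> k0 Xk x; rewrite -(@ler_sqr _ (rnorm (X x))) ?nnegrE ?rnorm_ge0//.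
  by rewrite exprMn.
by rewrite mulr_ge0// rnorm_ge0.
Qed.

(** Expanding [0 <= |(X - k) x|^2] gives
    [2 k <X x, x> <= |X x|^2 + k^2 |x|^2 <= 2 k^2 |x|^2]. *)
Lemma selfadjoint_le_bound k X : 0 < k -> selfadjoint X -> op_bounded k X ->
  positive (k%:C *: I - X).
Proof.
move=> k0 sX Xk; apply/scalar_positiveP; split=> // x.
have : 0 <= rdot ((X - k%:C *: I) x) ((X - k%:C *: I) x).
  by rewrite rdotxx exprn_ge0// rnorm_ge0.
rewrite !bopE !rdotE (rdotC x) !rdotxx.
have : rnorm (X x) ^+ 2 <= (k * rnorm x) ^+ 2.
  by rewrite ler_sqr ?nnegrE ?mulr_ge0 ?rnorm_ge0// ltW.
rewrite exprMn => Xk2 h.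
have : 2 * k * rdot (X x) x <= 2 * k * (k * rnorm x ^+ 2) by lra.
by rewrite ler_pM2l// mulr_gt0.
Qed.

(** The Cauchy-Schwarz inequality of the form [<T x, y>], in the only case that
    matters: it is [<T z, z> >= 0] at [z = x - k^-1 T x], combined with
    [<T (T x), T x> <= k |T x|^2]. *)
Lemma positive_norm_le k T : 0 < k -> positive T -> positive (k%:C *: I - T) ->
  forall x, rnorm (T x) ^+ 2 <= k * rdot (T x) x.
Proof.
move=> k0 T0 Tk x.
have [sT T0'] := (positiveP _).1 T0.
have [_ Tk'] := (scalar_positiveP _ _).1 Tk.
move/selfadjointP in sT.
have := T0' (x - k^-1%:C *: T x); have := Tk' (T x).
rewrite linearB linearZ/= !rdotE [rdot (T (T x)) x]sT !rdotxx => h1 h2.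
have : k * (k^-1 * (k^-1 * rdot (T (T x)) (T x))) <=
    k * (k^-1 * (k^-1 * (k * rnorm (T x) ^+ 2))).
  by rewrite !ler_pM2l// invr_gt0.
have : 0 <= k * (rdot (T x) x - k^-1 * rnorm (T x) ^+ 2 -
                     (k^-1 * (rnorm (T x) ^+ 2 - k^-1 * rdot (T (T x)) (T x)))).
  by apply: mulr_ge0; lra.
have k' : k != 0 by rewrite gt_eqF.
rewrite !mulrBr !mulrA !mulfV// !mul1r mulVf// mul1r; lra.
Qed.

Lemma positive_bounded k T : 0 < k -> positive T -> positive (k%:C *: I - T) ->
  op_bounded k T.
Proof.
move=> k0 T0 Tk; apply: op_bounded_sqr; first exact: ltW.
move=> x; apply: le_trans (positive_norm_le k0 T0 Tk x) _.
rewrite expr2 -mulrA ler_pM2l//.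
by have [_] := (scalar_positiveP _ _).1 Tk.
Qed.

(** If [S] inverts [T], then [|x| <= |S| |T x|], while [|T x|^2] is controlled
    by [<T x, x>] through [positive_norm_le]. *)
Lemma op_gt0_ge T : op_gt0 T -> exists2 c, 0 < c & positive (T - c%:C *: I).
Proof.
move=> [T0 [S [_ ST]]].
have [k k0 Tk] := op_boundedE T; have [l l0 Sl] := op_boundedE S.
have sT := positive_selfadjoint T0.
exists (k * l ^+ 2)^-1; first by rewrite invr_gt0 mulr_gt0// exprn_gt0.
apply/positive_scalarP; split=> // x.
rewrite ler_pdivrMl ?mulr_gt0 ?exprn_gt0//.
have : rnorm x ^+ 2 <= (l * rnorm (T x)) ^+ 2.
  rewrite ler_sqr ?nnegrE ?mulr_ge0 ?rnorm_ge0 ?(ltW l0)//.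
  by have := Sl (T x); rewrite -bop_mulE ST.
move=> /le_trans; apply; rewrite exprMn [leRHS]mulrAC [leLHS]mulrC.
rewrite ler_pM2r ?exprn_gt0//.
exact: positive_norm_le (selfadjoint_le_bound k0 sT Tk) x.
Qed.

Lemma op_le_anti X Y : op_le X Y -> op_le Y X -> X = Y.
Proof.
move=> [sX sY XY] [_ _ YX]; apply: subr0_eq; apply: bopP => x.
apply/rnorm_eq0/eqP; rewrite -sqrf_eq0 eq_le exprn_ge0 ?rnorm_ge0// andbT.
have [k k0 kXY] := op_boundedE (X - Y).
have := positive_norm_le k0 YX (selfadjoint_le_bound k0 (positive_selfadjoint YX) kXY) x.
move=> /le_trans; apply; rewrite pmulr_rle0//.
by have := ((positiveP _).1 XY).2 x; rewrite !bopE !rdotE; lra.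
Qed.

Lemma selfadjoint_bounds X : selfadjoint X -> exists2 k, 0 < k & positive (k%:C *: I - X).
Proof.
by move=> sX; have [k k0 kX] := op_boundedE X; exists k => //; exact: selfadjoint_le_bound.
Qed.

Lemma nontrivial_vector : I <> 0 -> exists x : H, 0 < rnorm x.
Proof.
move=> H0; apply: contrapT => h; apply: H0; apply: bopP => x; apply/eqP.
rewrite !bopE; apply: contrapT => /negP x_neq0; apply: h; exists x.
by rewrite lt_def rnorm_ge0 andbT; apply: contra x_neq0 => /eqP/rnorm_eq0/eqP.
Qed.

Lemma positive_scalar a : I <> 0 -> positive (a%:C *: I) -> 0 <= a.
Proof.
move=> /nontrivial_vector[x x0] /positiveP[_ /(_ x)].
by rewrite !bopE rdotZl rdotxx pmulr_lge0// exprn_gt0.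
Qed.

Lemma op_le_trivial X Y : I = 0 -> op_le X Y.
Proof.
move=> H0; have B0 (Z : 'B(H)) : Z = 0 by rewrite -(mul1r Z) H0 mul0r.
rewrite (B0 X) (B0 Y); apply: op_leP; first exact: selfadjoint0.
by rewrite subrr -(scale0r I); apply: (positiveZ (a := 0)) => //; exact: positive1.
Qed.

(** Two-sided bounds [Y <= c X] and [d X <= Z] compare [Y] with [Z] up to the
    gap [c - d] between the two constants. *)
Lemma op_le_slack c d X Y Z : op_le Y (c%:C *: X) -> op_le (d%:C *: X) Z ->
  op_le Y (Z + (c - d)%:C *: X).
Proof.
move=> [sY _ YX] [_ _ XZ]; apply: op_leP => //.
have -> : Z + (c - d)%:C *: X - Y = (c%:C *: X - Y) + (Z - d%:C *: X).
  by rewrite rscaleB addrCA addrAC.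
exact: positiveD.
Qed.

End OperatorAlgebra.

(** * Norm convergence in B(H) *)

Section NormConvergence.
Variables (R : realType) (H : hilbertType R).
Local Notation C := R[i].
Local Notation I := (1 : 'B(H)).
Implicit Types (x y z : H) (a b k s t e : R) (X Y Z S T : 'B(H)).
Implicit Types u v : nat -> 'B(H).

Lemma op_cvgP u Y :
  op_cvg u Y <-> forall e, 0 < e -> \forall n \near \oo, op_bounded e (u n - Y).
Proof.
split=> uY e e0.
  have : 0 < e%:C by rewrite ltcR.
  by move=> /uY; apply: filterS => n h x; have := h x; rewrite !normE -rmorphM/= lecR.
have eE : e = (complex.Re e)%:C by rewrite RRe_real// gtr0_real.
move: e0; rewrite eE ltcR => /uY; apply: filterS => n h x.
by have := h x; rewrite !normE -rmorphM/= lecR.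
Qed.

Lemma op_cvg_cst Y : op_cvg (fun=> Y) Y.
Proof.
apply/op_cvgP => e e0; apply: nearW => _ x.
by rewrite subrr bopE -(scale0r 0) rnormZ normr0 mul0r mulr_ge0 ?rnorm_ge0// ltW.
Qed.

Lemma op_cvg_unique u Y Z : op_cvg u Y -> op_cvg u Z -> Y = Z.
Proof.
move=> /op_cvgP uY /op_cvgP uZ; apply/subr0_eq/op_bounded_eq0 => e e0.
have e2 : 0 < e / 2 by rewrite divr_gt0.
have [n [uYn uZn]] := filter_ex (filterI (uY _ e2) (uZ _ e2)).
rewrite (splitr e) -(subrKA (u n)) addrC; apply: op_boundedD => //.
by rewrite -(opprB (u n)); exact: op_boundedN.
Qed.

Lemma op_cvgD u v Y Z : op_cvg u Y -> op_cvg v Z -> op_cvg (fun n => u n + v n) (Y + Z).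
Proof.
move=> /op_cvgP uY /op_cvgP vZ; apply/op_cvgP => e e0.
have e2 : 0 < e / 2 by rewrite divr_gt0.
apply: filterS2 (uY _ e2) (vZ _ e2) => n un vn.
by rewrite (splitr e) opprD addrACA; exact: op_boundedD.
Qed.

Lemma op_cvgM u v Y Z : op_cvg u Y -> op_cvg v Z -> op_cvg (fun n => u n * v n) (Y * Z).
Proof.
move=> /op_cvgP uY /op_cvgP vZ; apply/op_cvgP => e e0.
have [k k0 Yk] := op_boundedE Y; have [l l0 Zl] := op_boundedE Z.
have d0 : 0 < 1 + l + k by rewrite !addr_gt0.
pose d := Num.min 1 (e / (1 + l + k)).
have d_gt0 : 0 < d by rewrite lt_min ltr01 divr_gt0.
apply: filterS2 (uY _ d_gt0) (vZ _ d_gt0) => n un vn.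
have -> : u n * v n - Y * Z = (u n - Y) * (v n - Z) + (u n - Y) * Z + Y * (v n - Z).
  by rewrite -mulrDr subrK mulrBl mulrBr addrA subrK.
apply: (@op_bounded_le _ _ (d * d + d * l + k * d)).
  have -> : d * d + d * l + k * d = d * (d + l + k) by ring.
  apply: (@le_trans _ _ (d * (1 + l + k))).
    by rewrite ler_pM2l// !lerD2r ge_min lexx.
  by rewrite -ler_pdivlMr// ge_min lexx orbT.
apply: op_boundedD; first apply: op_boundedD; apply: op_boundedM => //; exact: ltW.
Qed.

Lemma op_cvg_selfadjoint u Y :
  (forall n, selfadjoint (u n)) -> op_cvg u Y -> selfadjoint Y.
Proof.
move=> su /op_cvgP uY; apply/selfadjointP => x y.
apply/eqP; rewrite -subr_eq0 -normr_le0; apply/ler_addgt0Pl => e e0; rewrite addr0.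
set r := 2 * (rnorm x * rnorm y) + 1.
have r0 : 0 < r by rewrite ltr_wpDl ?mulr_ge0 ?rnorm_ge0.
have := divr_gt0 e0 r0; have : e = e / r * r by rewrite divfK ?gt_eqF.
move: (e / r) => d de d0; have [n un] := filter_ex (uY _ d0).
have -> : rdot (Y x) y - rdot x (Y y) =
    rdot x ((u n - Y) y) - rdot ((u n - Y) x) y.
  by rewrite !bopE !rdotE ((selfadjointP _).1 (su n)); ring.
apply: le_trans (ler_normB _ _) _.
apply: le_trans (lerD (rdot_le _ _) (rdot_le _ _)) _.
have := ler_wpM2l (rnorm_ge0 x) (un y); have := ler_wpM2r (rnorm_ge0 y) (un x).
rewrite de /r; lra.
Qed.

(** Asking only that [u n + e] be eventually positive makes the lemma apply to
    polynomials that approximate a nonnegative function from either side. *)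
Lemma op_cvg_positive u Y : (forall n, selfadjoint (u n)) -> op_cvg u Y ->
  (forall e, 0 < e -> \forall n \near \oo, positive (u n + e%:C *: I)) ->
  positive Y.
Proof.
move=> su uY u0; apply/positiveP; split; first exact: op_cvg_selfadjoint uY.
move=> x; apply/ler_addgt0Pl => e e0.
set r := 2 * (rnorm x ^+ 2) + 1.
have r0 : 0 < r by rewrite ltr_wpDl// mulr_ge0// exprn_ge0// rnorm_ge0.
have := divr_gt0 e0 r0; have : e = e / r * r by rewrite divfK ?gt_eqF.
move: (e / r) => d de d0.
have [n [un pn]] := filter_ex (filterI ((op_cvgP _ _).1 uY _ d0) (u0 _ d0)).
have := rdot_le ((u n - Y) x) x; have := ler_wpM2r (rnorm_ge0 x) (un x).
have := ((positiveP _).1 pn).2 x; rewrite !bopE !rdotE rdotxx.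
rewrite ler_norml -mulrA -expr2 => h1 h2 /andP[_ h3].
rewrite de /r; lra.
Qed.

Definition op_cauchy u := forall e, 0 < e ->
  exists N, forall m n, (N <= m)%N -> (N <= n)%N -> op_bounded e (u m - u n).

(** Completeness of [B(H)]: pointwise limits exist because [H] is complete, and
    the Cauchy estimate passes to them with the same constant, which gives both
    their boundedness and the convergence in norm. *)
Lemma op_cauchy_cvg u : op_cauchy u -> exists Y, op_cvg u Y.
Proof.
move=> cu.
have ptc x : cvg (u n x @[n --> \oo]).
  apply/cauchy_cvgP/cauchyP => e e0.
  have eE : e = (complex.Re e)%:C by rewrite RRe_real// gtr0_real.
  have n1 : 0 < rnorm x + 1 by rewrite ltr_wpDl// rnorm_ge0.
  move: e0; rewrite eE ltcR => e0.
  have [N uN] := cu _ (divr_gt0 e0 n1).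
  exists (u N x); exists N => // n /= Nn.
  rewrite -ball_normE/= normE ltcR; apply: le_lt_trans (uN _ _ (leqnn N) Nn x) _.
  by rewrite mulrAC ltr_pdivrMr// ltr_pM2l// ltrDl.
pose Y x := lim (u n x @[n --> \oo]).
have uY x : u n x @[n --> \oo] --> Y x by exact: ptc.
have Ylin : linear Y.
  move=> a x y; apply: (@cvg_unique _ (@norm_hausdorff _ H) _ _ _ _ (uY _)).
  have -> : (fun n => u n (a *: x + y)) = (fun n => a *: u n x + u n y).
    by apply/funext => n; rewrite linearP.
  by apply: cvgD; [apply: cvgZr|].
have Ybd e : 0 < e -> exists N, forall n x, (N <= n)%N ->
    rnorm (u n x - Y x) <= e * rnorm x.
  move=> e0; have [N uN] := cu _ e0; exists N => n x Nn.
  apply/ler_addgt0Pl => d d0.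
  have d0' : 0 < d%:C by rewrite ltcR.
  have /cvgrPdist_le/(_ _ d0')[N' _ h] := uY x.
  have := h (maxn N N') (leq_maxr _ _); rewrite normE lecR => {}h.
  have := uN n (maxn N N') Nn (leq_maxl _ _) x.
  rewrite !bopE => /(lerD h); apply: le_trans.
  rewrite -[u n x - Y x](subrKA (u (maxn N N') x)) addrC; apply: le_trans (rnormD _ _) _.
  by rewrite -(rnormN (Y x - _)) opprB.
have YB : Y \in @bounded_linear R H.
  apply/bounded_linearP; split=> //.
  have [N h] := Ybd 1 ltr01; have [k k0 uk] := op_boundedE (u N).
  exists (k + 1)%:C => x; rewrite !normE -rmorphM/= lecR.
  rewrite -[Y x](subKr (u N x)); apply: le_trans (rnormD _ _) _.
  by rewrite rnormN mulrDl; apply: lerD; [exact: uk|exact: h].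
exists (BOp YB); apply/op_cvgP => e e0.
by have [N h] := Ybd e e0; exists N => // n /= Nn x; exact: h.
Qed.

Lemma positive_bounded_below c T : 0 < c -> positive (T - c%:C *: I) ->
  forall x, c * rnorm x <= rnorm (T x).
Proof.
move=> c0 /positive_scalarP[_ Tc] x.
have [->|x0] := eqVneq (rnorm x) 0; first by rewrite mulr0 rnorm_ge0.
have x1 : 0 < rnorm x by rewrite lt_def x0 rnorm_ge0.
rewrite -(ler_pM2r x1) -mulrA -expr2; apply: le_trans (Tc x) _.
exact: le_trans (ler_norm _) (rdot_le _ _).
Qed.

Lemma op_boundedX k X n : 0 <= k -> op_bounded k X -> op_bounded (k ^+ n) (X ^+ n).
Proof.
move=> k0 Xk; elim: n => [|n IH]; first by move=> x; rewrite !expr0 mul1r.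
by rewrite !exprS; exact: op_boundedM.
Qed.

(** The inverse is a Neumann series. For [k > c] that bounds the norm of [T],
    the operator [S = 1 - T / k] lies between [0] and [r = 1 - c / k],
    so its norm is at most [r < 1]. The partial sums [w n] of the powers of [S]
    satisfy [T w_n = k (1 - S^n)]; as [T] is bounded below by [c], this identity
    also shows that they form a Cauchy sequence. *)
Lemma positive_invertible c T : 0 < c -> positive (T - c%:C *: I) -> invertible T.
Proof.
move=> c0 Tc.
have [sT _] := (positive_scalarP _ _).1 Tc.
have [k [ck Tk]] : exists k, c < k /\ op_bounded k T.
  have [k k0 Tk] := op_boundedE T; exists (c + k); split; first by rewrite ltrDl.
  by apply: op_bounded_le Tk; rewrite lerDr ltW.
have k0 : 0 < k := lt_trans c0 ck.
pose S : 'B(H) := I - k^-1%:C *: T; pose r := 1 - k^-1 * c.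
have r0 : 0 < r by rewrite subr_gt0 mulrC ltr_pdivrMr// mul1r.
have r1 : r < 1 by rewrite ltrBlDr ltrDl mulr_gt0 ?invr_gt0.
have kZ (X : 'B(H)) a b : a%:C *: (b%:C *: X) = (a * b)%:C *: X :> 'B(H).
  by rewrite scalerA -rmorphM.
have Sr : op_bounded r S.
  apply: positive_bounded => //.
    have -> : S = k^-1%:C *: (k%:C *: I - T).
      by rewrite scalerBr kZ mulVf ?gt_eqF// scale1r.
    by apply: positiveZ; [rewrite invr_ge0 ltW|exact: selfadjoint_le_bound].
  have -> : r%:C *: I - S = k^-1%:C *: (T - c%:C *: I).
    by rewrite scalerBr kZ /r rmorphB/= scalerBl scale1r opprB addrC addrA subrK.
  by apply: positiveZ => //; rewrite invr_ge0 ltW.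
have IS : I - S = k^-1%:C *: T by rewrite subKr.
pose w n := \sum_(i < n) S ^+ i.
have wE n : T * w n = k%:C *: (I - S ^+ n).
  have -> : T = k%:C *: (I - S) by rewrite IS kZ mulfV ?gt_eqF// scale1r.
  by rewrite -bop_scaleAl -(opprB S) -(opprB _ I) subrX1 mulNr.
have Sn : op_cvg (fun n => S ^+ n) 0.
  apply/op_cvgP => e e0.
  have /cvgrPdist_le/(_ _ e0) : (fun n => r ^+ n) @ \oo --> (0 : R).
    by apply: cvg_expr; rewrite ger0_norm// ltW.
  apply: filterS => n; rewrite sub0r normrN ger0_norm ?exprn_ge0 ?(ltW r0)// => h.
  by rewrite subr0; apply: op_bounded_le h _; apply: op_boundedX => //; exact: ltW.
have wc : op_cauchy w.
  move=> e e0.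
  have d0 : 0 < e * c / k / 2 by rewrite !divr_gt0// mulr_gt0.
  have [N _ h] := (op_cvgP _ _).1 Sn _ d0; exists N => m n Nm Nn x.
  have : c * rnorm ((w m - w n) x) <= k * (e * c / k * rnorm x).
    apply: le_trans (positive_bounded_below c0 Tc _) _.
    rewrite -bop_mulE mulrBr !wE -scalerBr bopE rnormZ gtr0_norm// ler_pM2l//.
    have -> : I - S ^+ m - (I - S ^+ n) = (S ^+ n - 0) - (S ^+ m - 0).
      by rewrite !subr0 opprB addrC addrA subrK.
    rewrite (splitr (e * c / k)).
    by apply: op_boundedD; [exact: h|apply: op_boundedN; exact: h].
  have -> : k * (e * c / k * rnorm x) = c * (e * rnorm x).
    by field; rewrite gt_eqF.
  by rewrite ler_pM2l.
have [W wW] := op_cauchy_cvg wc.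
have TW : T * W = k%:C *: I.
  apply: op_cvg_unique (op_cvgM (op_cvg_cst T) wW) _ => /=.
  have -> : (fun n => T * w n) = (fun n => (k%:C *: I) * (I + (- I) * S ^+ n)).
    by apply/funext => n; rewrite wE -bop_scaleAl mul1r mulN1r.
  have := op_cvgM (op_cvg_cst (k%:C *: I))
    (op_cvgD (op_cvg_cst I) (op_cvgM (op_cvg_cst (- I)) Sn)).
  by rewrite mulr0 addr0 mulr1.
have TwC n : T * w n = w n * T.
  have ST : S * T = T * S by rewrite mulrBl mulrBr mul1r mulr1 -bop_scaleAl -bop_scaleAr.
  rewrite /w mulr_sumr mulr_suml; apply: eq_bigr => i _.
  by elim: (i : nat) => [|j IH]; rewrite ?expr0 ?mulr1 ?mul1r// exprS mulrA -ST -mulrA IH mulrA.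
have WT : W * T = T * W.
  apply: (op_cvg_unique (u := fun n => w n * T)).
    exact: op_cvgM wW (op_cvg_cst T).
  have -> : (fun n => w n * T) = (fun n => T * w n) by apply/funext => n; rewrite TwC.
  exact: op_cvgM (op_cvg_cst T) wW.
exists (k^-1%:C *: W); split.
  by rewrite -bop_scaleAr TW kZ mulVf ?gt_eqF// scale1r.
by rewrite -bop_scaleAl WT TW kZ mulVf ?gt_eqF// scale1r.
Qed.

End NormConvergence.

(** * Polynomials of an operator and its spectrum *)

Section Spectrum.
Variables (R : realType) (H : hilbertType R).
Local Notation C := R[i].
Local Notation I := (1 : 'B(H)).
Implicit Types (x y z : H) (a b k s t e : R) (X Y Z S T : 'B(H)).
Implicit Types (p q : {poly R}) (f g : {poly C}).

Lemma invertibleM X Y : invertible X -> invertible Y -> invertible (X * Y).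
Proof.
move=> [X' [XX' X'X]] [Y' [YY' Y'Y]]; exists (Y' * X'); split.
  by rewrite mulrA -(mulrA X) YY' mulr1.
by rewrite mulrA -(mulrA Y') X'X mulr1.
Qed.

Lemma invertible1 : invertible I.
Proof. by exists 1; rewrite mulr1. Qed.

Lemma invertibleZ (c : C) X : c != 0 -> invertible X -> invertible (c *: X).
Proof.
move=> c0 [Y [XY YX]]; exists (c^-1 *: Y).
by split; rewrite -bop_scaleAl -bop_scaleAr ?XY ?YX scalerA ?mulfV ?mulVf// scale1r.
Qed.

Lemma invertibleN X : invertible X -> invertible (- X).
Proof. by move=> [Y XY]; exists (- Y); rewrite !mulrNN. Qed.

Lemma invertible_factor X Y : X * Y = Y * X -> invertible (X * Y) -> invertible X.
Proof.
move=> XY [W [XYW WXY]]; exists (Y * W); split; first by rewrite mulrA.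
have -> : Y * W = W * Y.
  by rewrite -[LHS]mul1r -WXY XY -!mulrA (mulrA X Y W) XYW mulr1.
by rewrite -mulrA -XY.
Qed.

(** Complex counterpart of [op_poly], where polynomials split into linear
    factors. *)
Definition ceval X f : 'B(H) := \sum_(i < size f) f`_i *: (X ^+ i : 'B(H)).

Lemma ceval_widen n X f :
  (size f <= n)%N -> ceval X f = \sum_(i < n) f`_i *: (X ^+ i : 'B(H)).
Proof.
move=> fn; rewrite /ceval (big_ord_widen _ (fun i => f`_i *: (X ^+ i : 'B(H))) fn).
rewrite big_mkcond; apply: eq_bigr => i _; case: ltnP => // fi.
by rewrite nth_default// scale0r.
Qed.

Lemma cevalD X f g : ceval X (f + g) = ceval X f + ceval X g.
Proof.
rewrite (ceval_widen _ (size_polyD f g)).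
rewrite (@ceval_widen _ X _ (leq_maxl (size f) (size g))).
rewrite (@ceval_widen _ X _ (leq_maxr (size f) (size g))) -big_split/=.
by apply: eq_bigr => i _; rewrite coefD scalerDl.
Qed.

Lemma cevalZ X (c : C) f : ceval X (c *: f) = c *: ceval X f.
Proof.
rewrite (ceval_widen _ (size_scale_leq c f)) /ceval scaler_sumr.
by apply: eq_bigr => i _; rewrite coefZ scalerA.
Qed.

Lemma cevalC X (c : C) : ceval X c%:P = c *: I.
Proof.
by rewrite (ceval_widen _ (size_polyC_leq1 c)) big_ord1 coefC expr0.
Qed.

Lemma cevalMX X f : ceval X (f * 'X) = ceval X f * X.
Proof.
have sz : (size (f * 'X)%R <= (size f).+1)%N.
  by apply: leq_trans (size_polyMleq _ _) _; rewrite size_polyX addn2.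
rewrite (ceval_widen _ sz) big_ord_recl coefMX/= scale0r add0r /ceval mulr_suml.
by apply: eq_bigr => i _; rewrite coefMX/= -bop_scaleAl exprSr.
Qed.

Lemma ceval_comm X f : X * ceval X f = ceval X f * X.
Proof.
rewrite /ceval mulr_sumr mulr_suml; apply: eq_bigr => i _.
by rewrite -bop_scaleAl -bop_scaleAr -exprS exprSr.
Qed.

Lemma cevalM X f g : ceval X (f * g) = ceval X f * ceval X g.
Proof.
elim/poly_ind: f => [|f c IH].
  by rewrite mul0r -(scale0r 0) cevalZ scale0r mul0r.
rewrite mulrDl mul_polyC mulrAC !cevalD !cevalMX cevalZ cevalC IH.
by rewrite mulrDl -bop_scaleAl mul1r -!mulrA ceval_comm.
Qed.

Lemma op_polyE q X : op_poly q X = ceval X (map_poly (real_complex R) q).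
Proof.
by rewrite /ceval size_map_poly; apply: eq_bigr => i _; rewrite coef_map.
Qed.

Lemma op_polyD p q X : op_poly (p + q) X = op_poly p X + op_poly q X.
Proof. by rewrite !op_polyE rmorphD cevalD. Qed.

Lemma op_polyM p q X : op_poly (p * q) X = op_poly p X * op_poly q X.
Proof. by rewrite !op_polyE rmorphM cevalM. Qed.

Lemma op_polyZ a q X : op_poly (a *: q) X = a%:C *: op_poly q X.
Proof. by rewrite !op_polyE map_polyZ cevalZ. Qed.

Lemma op_polyC a X : op_poly a%:P X = a%:C *: I.
Proof. by rewrite op_polyE map_polyC cevalC. Qed.

Lemma op_polyX X : op_poly 'X X = X.
Proof.
rewrite op_polyE map_polyX -(mul1r 'X) cevalMX -polyC1 cevalC.
by rewrite scale1r mul1r.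
Qed.

Lemma op_polyN q X : op_poly (- q) X = - op_poly q X.
Proof. by rewrite -scaleN1r op_polyZ rmorphN scaleN1r. Qed.

Lemma op_polyB p q X : op_poly (p - q) X = op_poly p X - op_poly q X.
Proof. by rewrite op_polyD op_polyN. Qed.

Lemma op_poly_selfadjoint q X : selfadjoint X -> selfadjoint (op_poly q X).
Proof.
move=> sX; elim/poly_ind: q => [|q c IH].
  by rewrite op_polyC scale0r; exact: selfadjoint0.
rewrite op_polyD op_polyM op_polyX op_polyC.
apply: selfadjointD; last exact/selfadjointZ/selfadjoint1.
move=> x y; rewrite !bopE IH sX -!bop_mulE.
by rewrite op_polyE ceval_comm.
Qed.

(** With [z = a + ib] and [D = X - a], the product of [X - z] and of its
    conjugate is [D^2 + b^2 >= b^2 > 0], which is invertible, and a factor of an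
    invertible product of commuting operators is invertible. *)
Lemma selfadjoint_nonreal X (z : C) : selfadjoint X -> complex.Im z != 0 ->
  invertible (X - z *: I).
Proof.
case: z => a b /= sX b0; pose D : 'B(H) := X - a%:C *: I.
pose w : C := b*i.
have -> : X - (a +i* b) *: I = D - w *: I.
  rewrite /D -addrA -opprD -scalerDl; congr (_ - _ *: _).
  by apply/eqP; rewrite eq_complex/= addr0 add0r !eqxx.
have sD : selfadjoint D by apply: selfadjointB => //; exact/selfadjointZ.
move: D sD => D sD.
have w2 : - (w * w) = (b ^+ 2)%:C.
  apply/eqP; rewrite eq_complex/= !mul0r !mulr0 sub0r addr0 oppr0 opprK expr2.
  by rewrite !eqxx.
have DwE : (D - w *: I) * (D + w *: I) = D * D + (b ^+ 2)%:C *: I.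
  rewrite mulrDr !mulrBl -!bop_scaleAl -!bop_scaleAr mulr1 !mul1r addrA subrK.
  by rewrite scalerA -scaleNr w2.
have wDE : (D + w *: I) * (D - w *: I) = D * D + (b ^+ 2)%:C *: I.
  rewrite mulrDl !mulrBr -!bop_scaleAl -!bop_scaleAr mulr1 !mul1r addrA subrK.
  by rewrite scalerA -scaleNr w2.
apply: (@invertible_factor _ (D + w *: I)); first by rewrite DwE wDE.
rewrite DwE; apply: (@positive_invertible _ _ (b ^+ 2)).
  by rewrite exprn_even_gt0.
rewrite addrK -[X in X * _]mulr1; apply: positive_congr; last exact: positive1.
exact: sD.
Qed.

(** The bottom of a self-adjoint operator lies in its spectrum: take for [s] the
    least real number with [T + s] positive. Were [T + s] invertible, it would
    dominate some [c > 0] and [s] could be lowered by [c]. *)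
Lemma selfadjoint_bottom T : selfadjoint T -> I <> 0 ->
  exists s, positive (T + s%:C *: I) /\ ~ invertible (T + s%:C *: I).
Proof.
move=> sT H0.
have [x0 x0_gt0] := nontrivial_vector H0.
pose A := [set s | positive (T + s%:C *: I)].
have AP s : A s <-> forall x, - s * rnorm x ^+ 2 <= rdot (T x) x.
  rewrite /A/= -[s%:C]opprK -rmorphN scaleNr positive_scalarP.
  by split=> [[]|].
have [k k0 Tk] := op_boundedE T.
have Ak : A k.
  rewrite /A/= addrC -(opprK T); apply: selfadjoint_le_bound => //.
    exact: selfadjointN.
  exact: op_boundedN.
have Alb : has_lbound A.
  exists (- (rdot (T x0) x0 / rnorm x0 ^+ 2)) => s /AP/(_ x0) h.
  by rewrite lerNl ler_pdivlMr// exprn_gt0.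
have Ainf : has_inf A by split=> //; exists k.
have A0 : A (inf A).
  apply/AP => x; apply/ler_addgt0Pl => e e0.
  have n1 : 0 < rnorm x ^+ 2 + 1 by rewrite ltr_wpDl// exprn_ge0 ?rnorm_ge0.
  have [s /AP/(_ x) sx] := inf_adherent (divr_gt0 e0 n1) Ainf.
  have : e = e / (rnorm x ^+ 2 + 1) * (rnorm x ^+ 2 + 1) by rewrite divfK ?gt_eqF.
  have := divr_gt0 e0 n1; move: (e / _) => d d0 -> sd.
  have : 0 <= (inf A + d - s) * rnorm x ^+ 2.
    by rewrite mulr_ge0 ?exprn_ge0 ?rnorm_ge0// subr_ge0 ltW.
  lra.
exists (inf A); split=> // inv.
have [c c0] := op_gt0_ge (conj A0 inv).
rewrite -addrA -scalerBl -rmorphB => Ac.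
have := ge_inf Alb Ac; lra.
Qed.

Lemma spectrum_neq0 X : selfadjoint X -> I <> 0 -> exists t, spectrum X t%:C.
Proof.
move=> sX /(selfadjoint_bottom sX)[s [_ h]]; exists (- s).
move=> /invertibleN; rewrite opprB rmorphN scaleNr opprK; exact: h.
Qed.

(** The half of the spectral mapping theorem that matters here: split [q] into
    linear factors over [R[i]]; if none of its roots were in the spectrum, then
    [q(X)] would be a product of invertible operators. When [q = 0], what is
    needed is that the spectrum is not empty. *)
Lemma op_poly_noninvertible q X : selfadjoint X -> ~ invertible (op_poly q X) ->
  exists2 t, spectrum X t%:C & q.[t] = 0.
Proof.
move=> sX; have [->|q0] := eqVneq q 0.
  move=> h; have [|t Xt] := spectrum_neq0 sX; last by exists t => //; rewrite horner0.
  by move=> H0; apply: h; exists 0; rewrite mulr0 mul0r -H0.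
move=> h; apply: contrapT => noroot; apply: h.
have [rs] := closed_field_poly_normal (map_poly (real_complex R) q : {poly C}).
rewrite lead_coef_map_inj//; last exact: complexI.
move=> qE; rewrite op_polyE qE cevalZ; apply: invertibleZ.
  by rewrite (fmorph_eq0 (real_complex R)) lead_coef_eq0.
have : all (root (map_poly (real_complex R) q)) rs.
  apply/allP => z zrs; rewrite qE rootZ ?root_prod_XsubC//.
  by rewrite (fmorph_eq0 (real_complex R)) lead_coef_eq0.
elim: rs {qE} => [|z rs IH] /=.
  by rewrite big_nil cevalC scale1r => _; exact: invertible1.
move=> /andP[rz rrs]; rewrite big_cons cevalM; apply: invertibleM; last exact: IH.
have -> : ceval X ('X - z%:P) = X - z *: I.
  rewrite cevalD -polyCN cevalC scaleNr; congr (_ - _).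
  by rewrite -[RHS]op_polyX op_polyE map_polyX.
have [z_real|] := eqVneq (complex.Im z) 0; last exact: selfadjoint_nonreal.
have zE : z = (complex.Re z)%:C by apply/eqP; rewrite eq_complex/= z_real !eqxx.
rewrite zE -opprB; apply: invertibleN; apply: contrapT => Xz; apply: noroot.
exists (complex.Re z) => //; apply: complexI; rewrite rmorph0.
by move: rz; rewrite {1}zE => /rootP; rewrite horner_map.
Qed.

(** If [s] is the number that [selfadjoint_bottom] attaches to [q(X)], then the
    polynomial [q + s] has a root in the spectrum by [op_poly_noninvertible],
    so [s <= 0] and already [q(X)] is positive. *)
Theorem op_poly_positive q X : selfadjoint X ->
  (forall t, spectrum X t%:C -> 0 <= q.[t]) -> positive (op_poly q X).
Proof.
move=> sX q0; have [H0|H0] := pselect (I = 0).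
  by move=> x; rewrite -(bop_oneE (op_poly q X x)) H0 bopE linear0l.
have [s [Ts]] := selfadjoint_bottom (op_poly_selfadjoint q sX) H0.
rewrite -(op_polyC _ X) -op_polyD => /(op_poly_noninvertible sX)[t Xt].
rewrite hornerD hornerC => /eqP; rewrite addr_eq0 => /eqP qt.
have -> : op_poly q X = op_poly q X + s%:C *: I + (- s)%:C *: I.
  by rewrite rscaleN addrK.
by apply: positiveD => //; apply: positiveZ; [rewrite -qt q0|exact: positive1].
Qed.

(** Positivity of the polynomial [s^2 - q^2] on the spectrum turns into the
    operator inequality [q(X)^2 <= s^2]. *)
Lemma op_poly_bounded q X s : 0 <= s -> selfadjoint X ->
  (forall t, spectrum X t%:C -> `|q.[t]| <= s) -> op_bounded s (op_poly q X).
Proof.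
move=> s0 sX qs; apply: op_bounded_sqr => // x.
have /positiveP[_ /(_ x)] : positive (op_poly ((s ^+ 2)%:P - q ^+ 2) X).
  apply: op_poly_positive => // t /qs qt.
  rewrite hornerD hornerN hornerC horner_exp subr_ge0.
  by rewrite -[leLHS]real_normK ?num_real// ler_sqr.
rewrite op_polyB op_polyC expr2 op_polyM !bopE !rdotE subr_ge0.
by rewrite ((selfadjointP _).1 (op_poly_selfadjoint q sX)) !rdotxx.
Qed.

Lemma spectrum_ge a X t : positive (X - a%:C *: I) -> spectrum X t%:C -> a <= t.
Proof.
move=> Xa Xt; rewrite leNgt; apply/negP => ta; apply: Xt.
rewrite -opprB; apply: invertibleN; apply: (@positive_invertible _ _ (a - t)).
  by rewrite subr_gt0.
by rewrite rscaleB opprB subrKA.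
Qed.

Lemma spectrum_le b X t : positive (b%:C *: I - X) -> spectrum X t%:C -> t <= b.
Proof.
move=> Xb Xt; rewrite leNgt; apply/negP => ta; apply: Xt.
apply: (@positive_invertible _ _ (t - b)); first by rewrite subr_gt0.
by rewrite rscaleB opprB addrC subrKA.
Qed.

End Spectrum.

(** * Polynomial approximation of Lipschitz functions *)

Section Weierstrass.
Variable R : realType.
Implicit Types (f g h : R -> R) (a b s t v : R) (w : {poly R}) (u : nat -> R).

(** At a point where [w] takes the value [v], this is the mean of [u] under the
    binomial law of parameters [n] and [v], that is
    [\sum_(k <= n) 'C(n, k) v^k (1 - v)^(n - k) u k], computed by conditioning on
    the first trial. The recursive form reduces the moments to ring identities. *)
Fixpoint bernstein w u n : {poly R} :=
  if n is n'.+1 then w * bernstein w (u \o succn) n' + (1 - w) * bernstein w u n'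
  else (u 0)%:P.

Lemma bernstein_le w n u1 u2 t : 0 <= w.[t] <= 1 ->
  (forall k, (k <= n)%N -> u1 k <= u2 k) ->
  (bernstein w u1 n).[t] <= (bernstein w u2 n).[t].
Proof.
move=> /andP[w0 w1]; elim: n u1 u2 => [|n IH] u1 u2 u12 /=.
  by rewrite !hornerC u12.
rewrite !hornerE; apply: lerD; apply: ler_wpM2l; rewrite ?subr_ge0//;
  apply: IH => k kn.
  exact: u12.
by apply: u12; exact: leq_trans kn (leqnSn n).
Qed.

Lemma bernstein_second_moment w n (al be c : R) t :
  (bernstein w (fun k => al + be * (k%:R - c) ^+ 2) n).[t] =
  al + be * (n%:R * (w.[t] * (1 - w.[t])) + (n%:R * w.[t] - c) ^+ 2).
Proof.
elim: n c => [|n IH] c /=; first by rewrite hornerC; ring.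
rewrite hornerD !hornerM hornerD hornerN -polyC1 hornerC IH.
have -> : (bernstein w ((fun k => al + be * (k%:R - c) ^+ 2) \o succn) n).[t]
    = (bernstein w (fun k => al + be * (k%:R - (c - 1)) ^+ 2) n).[t].
  congr (bernstein w _ n).[t]; apply/funext => k /=.
  by rewrite -natr1; congr (_ + _ * _ ^+ 2); ring.
by rewrite IH -natr1; ring.
Qed.

Lemma norm_le_sqr (d x : R) : 0 < d -> `|x| <= d + d^-1 * x ^+ 2.
Proof.
move=> d0; rewrite -(ler_pM2l d0) mulrDr mulrA mulfV ?gt_eqF// mul1r.
rewrite -(real_normK (num_real x)); have := sqr_ge0 (d - `|x|).
have := sqr_ge0 d; have := sqr_ge0 `|x|; rewrite !expr2; lra.
Qed.

(** The Bernstein polynomials of [f] on the interval from [a] to [b]. *)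
Definition interpolated_bernstein f a b n :=
  bernstein ((b - a)^-1 *: ('X - a%:P))
    (fun k => f (a + (b - a) * (k%:R / n%:R))) n.

(** Weierstrass approximation by Bernstein polynomials. Let
    [t = a + (b - a) v] and let [s_k = a + (b - a) k/n] be the nodes. With
    [K = |L| (b - a) + 1] and any [d > 0], the Lipschitz condition gives
    [|f(s_k) - f(t)| <= K |k/n - v| <= K (d + (k/n - v)^2 / d)], and the mean of
    the right-hand side is [K d + K v (1 - v) / (n d)]. Taking [d = e / (2 K)]
    makes the first term [e / 2], and the second one tends to [0]. *)
Theorem lipschitz_unif_approx f a b L : a < b ->
  (forall s t, a <= s <= b -> a <= t <= b -> `|f s - f t| <= L * `|s - t|) ->
  forall e, 0 < e -> \forall n \near \oo, forall t, a <= t <= b ->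
    `|(interpolated_bernstein f a b n).[t] - f t| <= e.
Proof.
move=> ab fL e e0.
have D0 : 0 < b - a by rewrite subr_gt0.
pose K := `|L| * (b - a) + 1.
have K0 : 0 < K by rewrite ltr_wpDl// mulr_ge0// ltW.
pose d := e / (2 * K).
have d0 : 0 < d by rewrite divr_gt0// mulr_gt0.
near=> n => t /andP[at_ tb].
have n0 : (0 < n)%N by near: n; exists 1%N.
have nR0 : 0 < n%:R :> R by rewrite ltr0n.
pose v := (b - a)^-1 * (t - a).
have v0 : 0 <= v by rewrite mulr_ge0 ?invr_ge0 ?subr_ge0// ltW.
have v1 : v <= 1 by rewrite /v mulrC ler_pdivrMr// mul1r lerD2r.
have tE : t = a + (b - a) * v by rewrite /v mulrA mulfV ?gt_eqF// mul1r addrC subrK.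
have wt : ((b - a)^-1 *: ('X - a%:P)).[t] = v by rewrite !hornerE.
rewrite /interpolated_bernstein; move: v v0 v1 tE wt => v v0 v1 tE.
set w := _ *: _; set u := fun k => _; move: w => w wt.
have w01 : 0 <= w.[t] <= 1 by rewrite wt v0 v1.
pose be : R := K * d^-1 * (n%:R ^- 2).
have ub k : (k <= n)%N -> `|u k - f t| <= K * d + be * (k%:R - n%:R * v) ^+ 2.
  move=> kn.
  have kn0 : 0 <= k%:R / n%:R :> R by rewrite divr_ge0.
  have kn1 : k%:R / n%:R <= 1 :> R by rewrite ler_pdivrMr// mul1r ler_nat.
  have nv : (k%:R - n%:R * v) = n%:R * (k%:R / n%:R - v).
    by rewrite mulrBr mulrCA mulfV ?gt_eqF// mulr1.
  have : `|u k - f t| <= L * `|(b - a) * (k%:R / n%:R - v)|.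
    have -> : (b - a) * (k%:R / n%:R - v) = a + (b - a) * (k%:R / n%:R) - t.
      by rewrite tE; ring.
    apply: fL; last by rewrite at_ tb.
    rewrite lerDl mulr_ge0// ?(ltW D0)//= -lerBrDl.
    by rewrite -[leRHS]mulr1 ler_pM2l.
  rewrite normrM (gtr0_norm D0) mulrA => /le_trans; apply.
  apply: (@le_trans _ _ (K * `|k%:R / n%:R - v|)).
    apply: ler_wpM2r => //; rewrite /K -[leLHS]addr0; apply: lerD => //.
    by rewrite ler_pM2r// ler_norm.
  have -> : K * d + be * (k%:R - n%:R * v) ^+ 2 =
      K * (d + d^-1 * (k%:R / n%:R - v) ^+ 2).
    by rewrite /be nv; field; rewrite !gt_eqF.
  by rewrite ler_pM2l// norm_le_sqr.
have le : K * d + be * (n%:R * (v * (1 - v))) <= e.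
  have -> : K * d = e / 2 by rewrite /d; field; rewrite gt_eqF.
  have -> : be * (n%:R * (v * (1 - v))) = K / d / n%:R * (v * (1 - v)).
    by rewrite /be; field; rewrite !gt_eqF.
  suff : K / d / n%:R * (v * (1 - v)) <= e / 2 by lra.
  have : K / d / n%:R <= e / 2.
    rewrite ler_pdivrMr// [leRHS]mulrC -ler_pdivrMr ?divr_gt0//.
    by near: n; exact: nbhs_infty_ger.
  apply: le_trans; rewrite -[leRHS]mulr1; apply: ler_wpM2l.
    by apply/ltW/divr_gt0 => //; exact: divr_gt0.
  by rewrite mulr_ile1// ?subr_ge0// lerBlDr lerDl.
have mom al be' :
    (bernstein w (fun k => al + be' * (k%:R - n%:R * v) ^+ 2) n).[t] =
    al + be' * (n%:R * (v * (1 - v))).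
  by rewrite bernstein_second_moment wt subrr expr0n addr0.
rewrite ler_norml; apply/andP; split.
  rewrite lerBrDr.
  apply: (@le_trans _ _ (f t - K * d + - be * (n%:R * (v * (1 - v))))); first by lra.
  rewrite -mom; apply: bernstein_le => // k /ub.
  rewrite ler_norml => /andP[]; lra.
rewrite lerBlDr.
apply: (@le_trans _ _ (f t + K * d + be * (n%:R * (v * (1 - v))))); last by lra.
rewrite -mom; apply: bernstein_le => // k /ub.
rewrite ler_norml => /andP[]; lra.
Unshelve. all: by end_near. Qed.

End Weierstrass.

(** * Real powers *)

Section PowR.
Variable R : realType.
Implicit Types (a b s t p r x y M m : R).

Lemma ler_powR_nonpos r x y : r <= 0 -> 0 < x -> x <= y -> y `^ r <= x `^ r.
Proof.
move=> r0 x0 xy; rewrite -(opprK r) !(powRN _ (- r)).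
have y0 := lt_le_trans x0 xy.
rewrite lef_pV2 ?posrE ?powR_gt0//.
by rewrite ge0_ler_powR ?nnegrE ?oppr_ge0// ltW.
Qed.

(** [t `^ p] is monotone in [t], but the direction depends on the sign of [p];
    the sum of the values at both ends is a bound in either case. *)
Lemma powR_bound a b t p : 0 < a -> a <= t <= b -> t `^ p <= a `^ p + b `^ p.
Proof.
move=> a0 /andP[at_ tb]; have [p0|p0] := leP 0 p.
  rewrite -[leLHS]add0r lerD ?powR_ge0// ge0_ler_powR ?nnegrE//.
    exact: le_trans (ltW a0) at_.
  exact: le_trans (le_trans (ltW a0) at_) tb.
by rewrite -[leLHS]addr0 lerD ?powR_ge0// ler_powR_nonpos// ltW.
Qed.

Lemma powR_MVT p s t : 0 < s -> s < t ->
  exists2 c, s <= c <= t & t `^ p - s `^ p = p * c `^ (p - 1) * (t - s).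
Proof.
move=> s0 st.
have drv x : 0 < x -> is_derive x 1 (@powR R ^~ p) (p * x `^ (p - 1)).
  exact: is_derive1_powR.
have [||c] := @MVT R (@powR R ^~ p) (fun x => p * x `^ (p - 1)) s t st.
- by move=> x; rewrite in_itv/= => /andP[sx _]; apply: drv; exact: lt_trans sx.
- apply: continuous_in_subspaceT => x; rewrite inE/= in_itv/= => /andP[sx _].
  have /@ex_derive := drv x (lt_le_trans s0 sx).
  by move/derivable1_diffP/differentiable_continuous.
rewrite in_itv/= => /andP[sc ct] E; exists c => //.
by rewrite (ltW sc) (ltW ct).
Qed.

Lemma powR_lipschitz a b p s t : 0 < a -> a <= s <= b -> a <= t <= b ->
  `|s `^ p - t `^ p| <= `|p| * (a `^ (p - 1) + b `^ (p - 1)) * `|s - t|.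
Proof.
move=> a0; wlog st : s t / s <= t.
  move=> wl sab tab; have [|/ltW ts] := leP s t; first by move=> st; exact: wl.
  by rewrite distrC (distrC s); exact: wl.
move=> /andP[as_ sb] /andP[at_ tb].
move: st; rewrite le_eqVlt => /predU1P[->|st].
  by rewrite !subrr normr0 mulr0.
have [c /andP[sc ct] E] := powR_MVT p (lt_le_trans a0 as_) st.
rewrite distrC E !normrM (distrC s); apply: ler_wpM2r => //; apply: ler_wpM2l => //.
rewrite ger0_norm ?powR_ge0//; apply: powR_bound => //.
by rewrite (le_trans as_ sc) (le_trans ct tb).
Qed.

Lemma tsallis_fun_MVT p t : p != 0 -> 1 <= t ->
  exists2 c, 1 <= c <= t & p^-1 * (t `^ p - 1) = c `^ (p - 1) * (t - 1).
Proof.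
move=> p0; rewrite le_eqVlt => /predU1P[<-|t1].
  by exists 1; rewrite ?lexx// powR1 !subrr !mulr0.
have [c ct E] := powR_MVT p ltr01 t1; exists c => //.
by move: E; rewrite powR1 => ->; rewrite -mulrA mulKf.
Qed.

(** The slopes [c `^ (p - 1)] given by [tsallis_fun_MVT] have
    [m <= 1 <= c <= t <= M], and are decreasing in [c] for [p <= 1]. *)
Lemma tsallis_fun_concave p m M t : p != 0 -> p <= 1 -> 0 < m -> m <= 1 ->
  1 <= t <= M ->
  M `^ (p - 1) * (t - 1) <= p^-1 * (t `^ p - 1) <= m `^ (p - 1) * (t - 1).
Proof.
move=> p0 p1 m0 m1 /andP[t1 tM]; have [c /andP[c1 ct] ->] := tsallis_fun_MVT p0 t1.
have p1' : p - 1 <= 0 by rewrite subr_le0.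
apply/andP; split; apply: ler_wpM2r; rewrite ?subr_ge0//; apply: ler_powR_nonpos => //.
- exact: lt_le_trans ltr01 c1.
- exact: le_trans ct tM.
- exact: le_trans m1 c1.
Qed.

Lemma tsallis_fun_convex p m M t : 1 <= p -> 0 < m -> m <= 1 -> 1 <= t <= M ->
  m `^ (p - 1) * (t - 1) <= p^-1 * (t `^ p - 1) <= M `^ (p - 1) * (t - 1).
Proof.
move=> p1 m0 m1 /andP[t1 tM].
have p0 : p != 0 by rewrite gt_eqF// (lt_le_trans ltr01).
have [c /andP[c1 ct] ->] := tsallis_fun_MVT p0 t1.
have c0 := lt_le_trans ltr01 c1.
apply/andP; split; apply: ler_wpM2r; rewrite ?subr_ge0//;
  apply: ge0_ler_powR; rewrite ?nnegrE ?subr_ge0 ?(ltW m0) ?(ltW c0)//.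
- exact: le_trans m1 c1.
- exact: le_trans ler01 (le_trans t1 tM).
- exact: le_trans ct tM.
Qed.

End PowR.

(** * Continuous functional calculus *)

Section FunctionalCalculus.
Variables (R : realType) (H : hilbertType R).
Local Notation C := R[i].
Local Notation I := (1 : 'B(H)).
Implicit Types (x y z : H) (a b k l s t e M m r : R) (X Y Z S T A B : 'B(H)).
Implicit Types (f g : R -> R) (q : {poly R}).

Lemma is_op_fun_selfadjoint f X Y : selfadjoint X -> is_op_fun f X Y -> selfadjoint Y.
Proof.
move=> sX [q [_ qY]]; apply: op_cvg_selfadjoint qY => n.
exact: op_poly_selfadjoint.
Qed.

(** Monotonicity is the basic property of the calculus: it contains the
    uniqueness of [f(X)], hence every identity between functions of [X]. If
    polynomials [p n] and [q n] approximate [f] and [g] within [e / 2], then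
    [q n - p n + e] is nonnegative on the spectrum. *)
Lemma is_op_fun_le f g X Y Z : selfadjoint X -> is_op_fun f X Y -> is_op_fun g X Z ->
  (forall t, spectrum X t%:C -> f t <= g t) -> op_le Y Z.
Proof.
move=> sX fY gZ fg; apply: op_leP; first exact: is_op_fun_selfadjoint fY.
have [[p [pf pY]] [q [qg qZ]]] := (fY, gZ).
have sqp n : selfadjoint (op_poly (q n - p n) X) by exact: op_poly_selfadjoint.
apply: (op_cvg_positive sqp) => [|e e0].
  have -> : (fun n => op_poly (q n - p n) X) =
      (fun n => op_poly (q n) X + (- I) * op_poly (p n) X).
    by apply/funext => n; rewrite op_polyB mulN1r.
  rewrite -(mulN1r Y); apply: op_cvgD => //; apply: op_cvgM => //.
  exact: op_cvg_cst.
have e2 : 0 < e / 2 by rewrite divr_gt0.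
apply: filterS2 (pf _ e2) (qg _ e2) => n pn qn.
rewrite -(op_polyC _ X) -op_polyD; apply: op_poly_positive => // t Xt.
rewrite hornerD hornerC hornerD hornerN.
have := pn t Xt; have := qn t Xt; have := fg t Xt.
rewrite !ler_norml => ? /andP[? ?] /andP[? ?]; lra.
Qed.

Lemma is_op_fun_unique f g X Y Z : selfadjoint X ->
  is_op_fun f X Y -> is_op_fun g X Z ->
  (forall t, spectrum X t%:C -> f t = g t) -> Y = Z.
Proof.
move=> sX fY gZ fg; apply: op_le_anti.
  by apply: is_op_fun_le fY gZ _ => // t /fg ->.
by apply: is_op_fun_le gZ fY _ => // t /fg ->.
Qed.

Lemma is_op_fun_poly q X : is_op_fun (horner q) X (op_poly q X).
Proof.
exists (fun=> q); split; last exact: op_cvg_cst.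
by move=> e e0; apply: nearW => _ t _; rewrite subrr normr0 ltW.
Qed.

Lemma is_op_fun_affine f X Y a : is_op_fun f X Y ->
  is_op_fun (fun t => a * (f t - 1)) X (a%:C *: (Y - I)).
Proof.
move=> [q [qf qY]]; exists (fun n => a *: (q n - 1%:P)); split.
  move=> e e0; have a1 : 0 < `|a| + 1 by rewrite ltr_wpDl.
  apply: filterS (qf _ (divr_gt0 e0 a1)) => n qn t Xt.
  rewrite hornerZ hornerD hornerN hornerC -mulrBr normrM opprB addrA subrK.
  apply: (@le_trans _ _ ((`|a| + 1) * (e / (`|a| + 1)))).
    by apply: ler_pM => //; [rewrite lerDl|exact: qn].
  by rewrite mulrC divfK ?gt_eqF.
have -> : (fun n => op_poly (a *: (q n - 1%:P)) X) =
    (fun n => (a%:C *: I) * (op_poly (q n) X - I)).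
  apply/funext => n.
  by rewrite op_polyZ op_polyB op_polyC rscale1 -bop_scaleAl mul1r.
rewrite -[Y - _]mul1r bop_scaleAl.
apply: op_cvgM; first exact: op_cvg_cst.
by apply: op_cvgD => //; exact: op_cvg_cst.
Qed.

Lemma is_op_funM f g X Y Z k l :
  (forall t, spectrum X t%:C -> `|f t| <= k) ->
  (forall t, spectrum X t%:C -> `|g t| <= l) ->
  is_op_fun f X Y -> is_op_fun g X Z ->
  is_op_fun (fun t => f t * g t) X (Y * Z).
Proof.
move=> fk gl [p [pf pY]] [q [qg qZ]]; exists (fun n => p n * q n); split.
  move=> e e0; pose D := `|k| + `|l| + 1.
  have D0 : 0 < D by rewrite ltr_wpDl// addr_ge0.
  pose d := Num.min 1 (e / D).
  have d0 : 0 < d by rewrite lt_min ltr01 divr_gt0.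
  have d1 : d <= 1 by rewrite ge_min lexx.
  have dD : d * D <= e by rewrite -ler_pdivlMr// ge_min lexx orbT.
  apply: filterS2 (pf _ d0) (qg _ d0) => n pn qn t Xt; rewrite hornerM.
  have -> : (p n).[t] * (q n).[t] - f t * g t =
     ((p n).[t] - f t) * ((q n).[t] - g t) + ((p n).[t] - f t) * g t + f t * ((q n).[t] - g t) by ring.
  apply: le_trans dD.
  have -> : d * D = d * 1 + d * `|l| + `|k| * d by rewrite /D; ring.
  apply: le_trans (ler_normD _ _)
    (lerD (le_trans (ler_normD _ _) (lerD _ _)) _);
    rewrite normrM; apply: ler_pM => //.
  - exact: pn.
  - exact: le_trans (qn t Xt) d1.
  - exact: pn.
  - exact: le_trans (gl t Xt) (ler_norm _).
  - exact: le_trans (fk t Xt) (ler_norm _).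
  - exact: qn.
have -> : (fun n => op_poly (p n * q n) X) =
    (fun n => op_poly (p n) X * op_poly (q n) X).
  by apply/funext => n; rewrite op_polyM.
exact: op_cvgM.
Qed.

Lemma op_unif_cauchy_cvg f X (q : nat -> {poly R}) : selfadjoint X ->
  unif_cvg_on [set t | spectrum X t%:C] q f ->
  exists Y, op_cvg (fun n => op_poly (q n) X) Y.
Proof.
move=> sX qf; apply: op_cauchy_cvg => e e0.
have e2 : 0 < e / 2 by rewrite divr_gt0.
have [N _ h] := qf _ e2; exists N => m n Nm Nn.
rewrite -op_polyB; apply: op_poly_bounded => //; first exact: ltW.
move=> t Xt; rewrite hornerD hornerN -[(q m).[t]](subrK (f t)) -addrA (splitr e).
apply: le_trans (ler_normD _ _) _.
by apply: lerD; [exact: h|rewrite distrC; exact: h].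
Qed.

Lemma spectrum_itv a b X t : positive (X - a%:C *: I) -> positive (b%:C *: I - X) ->
  spectrum X t%:C -> a <= t <= b.
Proof. by move=> Xa Xb Xt; rewrite (spectrum_ge Xa Xt) (spectrum_le Xb Xt). Qed.

(** Existence of [X^p]: [t `^ p] is Lipschitz on an interval that contains the
    spectrum and stays away from [0], so Bernstein polynomials approximate it
    uniformly there, and [op_poly_bounded] makes their values at [X] a Cauchy
    sequence. *)
Theorem op_powP a X p : 0 < a -> positive (X - a%:C *: I) ->
  is_op_fun (fun t => t `^ p) X (op_pow X p).
Proof.
move=> a0 Xa; have [sX _] := (positive_scalarP _ _).1 Xa.
have [k k0 Xk] := selfadjoint_bounds sX.
(* [k + a] rather than [k]: the interval must have positive length. *)
have ab : a < k + a by rewrite ltrDr.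
have Xb t : spectrum X t%:C -> a <= t <= k + a.
  move=> Xt; rewrite (spectrum_ge Xa Xt)/= (le_trans (spectrum_le Xk Xt))//.
  by rewrite lerDl ltW.
pose f t := t `^ p; pose q := interpolated_bernstein f a (k + a).
have qf : unif_cvg_on [set t | spectrum X t%:C] q f.
  move=> e e0; have := lipschitz_unif_approx ab _ e0.
  move=> /(_ _ _ (fun s t => @powR_lipschitz _ _ _ p s t a0)).
  by apply: filterS => n qn t /Xb; exact: qn.
have [Y qY] := op_unif_cauchy_cvg sX qf.
by apply: (@xgetPex _ 0 [set Y | is_op_fun f X Y]); exists Y; exists q.
Qed.

Lemma op_pow_selfadjoint a X p : 0 < a -> positive (X - a%:C *: I) ->
  selfadjoint (op_pow X p).
Proof.
move=> a0 Xa; have [sX _] := (positive_scalarP _ _).1 Xa.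
exact: is_op_fun_selfadjoint (op_powP p a0 Xa).
Qed.

Lemma op_powD a X p r : 0 < a -> positive (X - a%:C *: I) ->
  op_pow X (p + r) = op_pow X p * op_pow X r.
Proof.
move=> a0 Xa; have [sX _] := (positive_scalarP _ _).1 Xa.
have [k k0 Xk] := selfadjoint_bounds sX.
have bd s t : spectrum X t%:C -> `|t `^ s| <= a `^ s + k `^ s.
  move=> Xt; rewrite ger0_norm ?powR_ge0//; apply: powR_bound => //.
  exact: spectrum_itv Xt.
apply: (is_op_fun_unique sX (op_powP _ a0 Xa)).
  exact: is_op_funM (bd p) (bd r) (op_powP p a0 Xa) (op_powP r a0 Xa).
move=> t /(spectrum_ge Xa) a_t; have t0 := lt_le_trans a0 a_t.
by rewrite /= powRD// (gt_eqF t0) implybT.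
Qed.

Lemma op_pow0 a X : 0 < a -> positive (X - a%:C *: I) -> op_pow X 0 = 1.
Proof.
move=> a0 Xa; have [sX _] := (positive_scalarP _ _).1 Xa.
have := is_op_fun_poly 1%:P X; rewrite op_polyC scale1r => X1.
apply: (is_op_fun_unique sX (op_powP _ a0 Xa) X1) => t _.
by rewrite powRr0 hornerC.
Qed.

Lemma op_pow1 a X : 0 < a -> positive (X - a%:C *: I) -> op_pow X 1 = X.
Proof.
move=> a0 Xa; have [sX _] := (positive_scalarP _ _).1 Xa.
have := is_op_fun_poly 'X X; rewrite op_polyX => X1.
apply: (is_op_fun_unique sX (op_powP _ a0 Xa) X1) => t /(spectrum_ge Xa) a_t.
by rewrite hornerX powRr1// (le_trans (ltW a0)).
Qed.

(** * Bounds for the Tsallis relative operator entropy *)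

Section SquareRoot.
Variables (a : R) (A : 'B(H)).
Hypotheses (a0 : 0 < a) (Aa : positive (A - a%:C *: I)).
Local Notation S := (op_pow A 2^-1).
Local Notation V := (op_pow A (- 2^-1)).

Lemma op_sqrtV : S * V = 1.
Proof. by rewrite -(op_powD _ _ a0 Aa) subrr (op_pow0 a0 Aa). Qed.

Lemma op_Vsqrt : V * S = 1.
Proof. by rewrite -(op_powD _ _ a0 Aa) addNr (op_pow0 a0 Aa). Qed.

Lemma op_sqrt_sqr : S * S = A.
Proof.
rewrite -(op_powD _ _ a0 Aa); have -> : 2^-1 + 2^-1 = 1 :> R by field.
exact: op_pow1 Aa.
Qed.

Lemma op_sqrtK B : S * (V * B * V) * S = B.
Proof. by rewrite !mulrA op_sqrtV mul1r -mulrA op_Vsqrt mulr1. Qed.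

Lemma op_VA : V * A * V = 1.
Proof. by rewrite -{2}op_sqrt_sqr mulrA op_Vsqrt mul1r op_sqrtV. Qed.

End SquareRoot.

Lemma op_le_sandwich a A B M : 0 < a -> positive (A - a%:C *: I) ->
  op_le A B -> op_le B (M%:C *: A) ->
  let X := op_pow A (- 2^-1) * B * op_pow A (- 2^-1) in
  op_le 1 X /\ op_le X (M%:C *: I).
Proof.
move=> a0 Aa AB BM X; have sV := op_pow_selfadjoint (- 2^-1) a0 Aa.
split; first by rewrite -(op_VA a0 Aa); exact: op_le_congr.
by rewrite -(op_VA a0 Aa) bop_scaleAl bop_scaleAr; exact: op_le_congr.
Qed.

(** Below, [T_p(A|B)] is the congruence by [A^(1/2)] of [p^-1 (X^p - 1)], and
    [c (B - A)] that of [c (X - 1)], where [X] is the operator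
    [A^(-1/2) B A^(-1/2)], with spectrum in the interval from [1] to [M].
    An inequality between the functions [p^-1 (t^p - 1)] and [c (t - 1)] on that
    interval is all that is needed to compare them. *)
Section TsallisBounds.
Variables (a M p c : R) (A B : 'B(H)).
Hypotheses (a0 : 0 < a) (Aa : positive (A - a%:C *: I)).
Hypotheses (AB : op_le A B) (BM : op_le B (M%:C *: A)).
Local Notation S := (op_pow A 2^-1).
Local Notation X := (op_pow A (- 2^-1) * B * op_pow A (- 2^-1)).

Let sqrt_congr Z : S * (Z - I) * S = S * Z * S - A.
Proof. by rewrite mulrBr mulrBl mulr1 (op_sqrt_sqr a0 Aa). Qed.

Lemma tsallisE : tsallis p A B = S * (p^-1%:C *: (op_pow X p - I)) * S.
Proof. by rewrite -bop_scaleAr -bop_scaleAl sqrt_congr. Qed.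

Lemma scale_subE : c%:C *: (B - A) = S * (c%:C *: (X - I)) * S.
Proof. by rewrite -bop_scaleAr -bop_scaleAl sqrt_congr (op_sqrtK a0 Aa). Qed.

Let X1 : positive (X - (1 : R)%:C *: I).
Proof. by have [[_ _]] := op_le_sandwich a0 Aa AB BM; rewrite rscale1. Qed.

Let sX : selfadjoint X.
Proof. by have [[]] := op_le_sandwich a0 Aa AB BM. Qed.

Let X1M t : spectrum X t%:C -> 1 <= t <= M.
Proof.
by have [_ [_ _ XM]] := op_le_sandwich a0 Aa AB BM; exact: spectrum_itv X1 XM.
Qed.

Let sS : selfadjoint S.
Proof. exact: op_pow_selfadjoint Aa. Qed.

Let tsallis_fun : is_op_fun (fun t => p^-1 * (t `^ p - 1)) X
  (p^-1%:C *: (op_pow X p - I)).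
Proof. by apply: is_op_fun_affine; exact: op_powP X1. Qed.

Let linear_fun : is_op_fun (fun t => c * (t - 1)) X (c%:C *: (X - I)).
Proof.
apply: is_op_fun_affine; have := is_op_fun_poly 'X X; rewrite op_polyX.
by rewrite (_ : horner 'X = id)//; apply/funext => t; rewrite hornerX.
Qed.

Lemma tsallis_ge :
  (forall t, 1 <= t <= M -> c * (t - 1) <= p^-1 * (t `^ p - 1)) ->
  op_le (c%:C *: (B - A)) (tsallis p A B).
Proof.
move=> cp; rewrite tsallisE scale_subE; apply: op_le_congr => //.
by apply: is_op_fun_le linear_fun tsallis_fun _ => // t /X1M; exact: cp.
Qed.

Lemma tsallis_le :
  (forall t, 1 <= t <= M -> p^-1 * (t `^ p - 1) <= c * (t - 1)) ->
  op_le (tsallis p A B) (c%:C *: (B - A)).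
Proof.
move=> cp; rewrite tsallisE scale_subE; apply: op_le_congr => //.
by apply: is_op_fun_le tsallis_fun linear_fun _ => // t /X1M; exact: cp.
Qed.

End TsallisBounds.

(** * Unital positive maps *)

Section PositiveMap.
Variable Phi : {linear 'B(H) -> 'B(H)}.
Hypotheses (Phi_pos : positive_map Phi) (Phi1 : unital_map Phi).

(** A self-adjoint operator is a difference of the two positive operators [k]
    and [k - X]. *)
Lemma positive_map_selfadjoint X : selfadjoint X -> selfadjoint (Phi X).
Proof.
move=> sX; have [k k0 kX] := selfadjoint_bounds sX.
have -> : Phi X = k%:C *: I - Phi (k%:C *: I - X).
  by rewrite linearB linearZ/= Phi1 subKr.
apply: selfadjointB; first exact/selfadjointZ/selfadjoint1.
exact/positive_selfadjoint/Phi_pos.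
Qed.

Lemma positive_map_le X Y : op_le X Y -> op_le (Phi X) (Phi Y).
Proof.
move=> [sX sY XY]; split; [exact: positive_map_selfadjoint..|].
by rewrite -linearB; exact: Phi_pos.
Qed.

Lemma positive_map_ge a X : positive (X - a%:C *: I) -> positive (Phi X - a%:C *: I).
Proof. by move=> /Phi_pos; rewrite linearB linearZ/= Phi1. Qed.

End PositiveMap.

End FunctionalCalculus.

Theorem theorem1 (R : realType) (H : hilbertType R) (A B : 'B(H)) (m M : R)
    (Phi : {linear 'B(H) -> 'B(H)})
    (A_gt0 : op_gt0 A) (B_gt0 : op_gt0 B)
    (m_gt0 : op_gt0 (m%:C *: (1 : 'B(H))))
    (m_le1 : op_le (m%:C *: (1 : 'B(H))) 1)
    (ge1 : op_le 1 (op_pow A (- 2^-1) * B * op_pow A (- 2^-1)))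
    (le_M : op_le (op_pow A (- 2^-1) * B * op_pow A (- 2^-1)) (M%:C *: (1 : 'B(H))))
    (Phi_pos : positive_map Phi) (Phi_unital : unital_map Phi) :
  (forall p : R, -1 <= p <= 1 -> p != 0 ->
     op_le (tsallis p (Phi A) (Phi B))
           (Phi (tsallis p A B)
            + (m `^ (p - 1) - M `^ (p - 1))%:C *: Phi (B - A)))
  /\
  (forall p : R, 1 <= p <= 2 ->
     op_le (Phi (tsallis p A B))
           (tsallis p (Phi A) (Phi B)
            + (M `^ (p - 1) - m `^ (p - 1))%:C *: Phi (B - A))).
Proof.
(* On a trivial space every operator is [0], and [m_gt0] says nothing of [m]. *)
have [H0|H0] := pselect ((1 : 'B(H)) = 0).
  by split=> *; exact: op_le_trivial.
have [m_pos m_inv] := m_gt0.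
have m0 : 0 < m.
  rewrite lt_def (positive_scalar H0 m_pos) andbT; apply/eqP => m0.
  by case: m_inv => Y [mY _]; apply: H0; rewrite -mY m0 scale0r mul0r.
have m1 : m <= 1.
  have [_ _ h] := m_le1; rewrite -subr_ge0; apply: (positive_scalar H0).
  by rewrite rscaleB rscale1.
have [a a0 Aa] := op_gt0_ge A_gt0.
have sS := op_pow_selfadjoint 2^-1 a0 Aa.
have AB : op_le A B.
  have := op_le_congr sS ge1; rewrite (op_sqrtK a0 Aa) mulr1.
  by rewrite (op_sqrt_sqr a0 Aa).
have BM : op_le B (M%:C *: A).
  have := op_le_congr sS le_M; rewrite (op_sqrtK a0 Aa).
  by rewrite -bop_scaleAr -bop_scaleAl mulr1 (op_sqrt_sqr a0 Aa).
have PAa := positive_map_ge Phi_pos Phi_unital Aa.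
have PAB := positive_map_le Phi_pos Phi_unital AB.
have PBM : op_le (Phi B) (M%:C *: Phi A).
  by rewrite -linearZ; exact: positive_map_le.
have PhiZ c : c%:C *: Phi (B - A) = Phi (c%:C *: (B - A)) by rewrite linearZ.
split=> p /andP[p1 p2] => [p0|].
  (* [m^(p-1)] bounds the entropy of the images from above, and [M^(p-1)] the
     image of the entropy from below; for [p >= 1] the roles are exchanged. *)
  have bds t : 1 <= t <= M -> _ := tsallis_fun_concave p0 p2 m0 m1.
  apply: op_le_slack; last first.
    rewrite PhiZ; apply: positive_map_le => //.
    by apply: (tsallis_ge a0 Aa AB BM) => t /bds/andP[].
  rewrite linearB; apply: (tsallis_le a0 PAa PAB PBM) => t /bds/andP[_].
  exact.
have bds t : 1 <= t <= M -> _ := tsallis_fun_convex p1 m0 m1.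
apply: op_le_slack.
  rewrite PhiZ; apply: positive_map_le => //.
  by apply: (tsallis_le a0 Aa AB BM) => t /bds/andP[].
by rewrite linearB; apply: (tsallis_ge a0 PAa PAB PBM) => t /bds/andP[].
Qed.
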